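(* Let $A$ be a commutative ring. Let $n\mapsto\psi(n)$, $n\ge 1$, be a function from the positive integers to $A$ and let $(b_n^i)_{n\ge2,\,1\le i\le n-1}$ be a double sequence of elements of $A$. Let $(u_n)_{n\ge1}$ be the sequence of elements of $A$ defined by $u_1=\psi(1)$ and the recurrence relation $$u_n=\psi(n)-\sum_{i=1}^{n-1}b_n^i\,u_i\qquad(n\ge 2).$$ Then, for every $n\ge1$, $$u_n=\psi(n)+\sum_{i=1}^{n-1}\psi(i)\sum_{s=0}^{n-1-i}(-1)^{s+1}\sum_{n=v_0>v_1>\cdots>v_s>v_{s+1}=i}\ \prod_{u=0}^{s}b_{v_u}^{v_{u+1}},$$ where the innermost sum runs over all strictly decreasing sequences of integers $(v_0,v_1,\dots,v_{s+1})$ with $v_0=n$ and $v_{s+1}=i$.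
   Context: The superscript in $b_n^i$ is an index, not an exponent; $\psi$ and $b_n^i$ are arbitrary. *)

(* Defs.v *)
From HB Require Import structures.
From mathcomp Require Import all_boot all_order all_algebra.
Set Implicit Arguments.
Unset Strict Implicit.
Unset Printing Implicit Defensive.

(* The terms of a strictly decreasing sequence of integers from n down to i   *)
(* with 1 <= i lie in {i, ..., n}, so ranging over 'I_n.+1 loses none of them *)
(* and makes the index set of the sum finite.                                 *)
Definition decreasing_chain (n i s : nat) (v : s.+2.-tuple 'I_n.+1) : bool :=
  [&& sorted gtn [seq val x | x <- v],
      tnth v ord0 == n :> nat & tnth v ord_max == i :> nat].

(* Main.v *)
Require Import Defs.
From HB Require Import structures.
From mathcomp Require Import all_boot all_order all_algebra.
Import GRing.Theory.
Local Open Scope ring_scope.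

(** Let [B] be the strictly lower triangular matrix whose entry at [(n, i)], for
    [i < n], is [b n i].  The recurrence says [(1 + B) u = psi] on the
    positive indices, and [B] is nilpotent in each finite range of them, so that
    [u = \sum_t (-1) ^+ t * B ^ t psi] is a finite geometric series.  The entry
    of [B ^ t] at [(n, i)] is the sum, over the strictly decreasing chains with
    [t] steps from [n] to [i], of the products of the [b] along the chain.  The
    term [t = 0] contributes [psi n], and [t = s + 1] gives the inner sums of
    the theorem.

    The entries of [B ^ t] are introduced as [chain_sum], by recursion on [t].
    Lemma [sum_chains] identifies them with sums over tuples by splitting off
    the first step of a chain; [chain_sum_eq0] is the nilpotency;
    [neumann_sumS] is the identity that makes the geometric series an inverse
    of [1 + B], and [recurrence_neumann] deduces the formula for [u n] from it
    by strong induction. *)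

(** The entry at [(n, i)] of the [t]-th power of the matrix [B]. *)
Fixpoint chain_sum (A : pzRingType) (b : nat -> nat -> A) (t n i : nat) : A :=
  if t is t'.+1 then \sum_(0 <= m < n) b n m * chain_sum A b t' m i
  else (n == i)%:R.

(** Each step of a chain lowers the index by at least one, so a chain with [t]
    steps needs [i + t <= n]. *)
Lemma chain_sum_eq0 (A : pzRingType) (b : nat -> nat -> A) (t n i : nat) :
  (n < i + t)%N -> chain_sum A b t n i = 0.
Proof.
elim: t n => [|t IHt] n /=; first by rewrite addn0 => /ltn_eqF ->.
move=> lt_n; rewrite big_nat_cond big1 // => m /andP[lt_mn _].
by rewrite IHt ?mulr0 // -ltnS -addnS; apply: leq_trans lt_n.
Qed.

(** Compared with [decreasing_chain], the starting point [n] is independent of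
    the bound [N] on the terms, so that the tail of a chain is again a chain in
    the same type of indices; and chains with a single term are allowed, so
    that the induction can start from [t = 0]. *)
Definition chain_from (N t n i : nat) (v : t.+1.-tuple 'I_N.+1) : bool :=
  [&& sorted gtn [seq val x | x <- v],
      tnth v ord0 == n :> nat & tnth v ord_max == i :> nat].
Arguments chain_from {N t}.

Definition chain_prod (A : pzRingType) (b : nat -> nat -> A) (N t : nat)
    (v : t.+1.-tuple 'I_N.+1) : A :=
  \prod_(k < t) b (tnth v (inord k)) (tnth v (inord k.+1)).
Arguments chain_prod {A} b {N t}.

Lemma chain_from_cons (N t n i : nat) (x : 'I_N.+1) (w : t.+1.-tuple 'I_N.+1) :
  chain_from n i [tuple of x :: w] =
  [&& x == n :> nat, (tnth w ord0 < n)%N & chain_from (tnth w ord0) i w].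
Proof.
rewrite /chain_from eqxx /= !(tnth_nth x) /=.
case: w => -[|y w] //= _.
by case: eqP => [->|]; rewrite ?andbF //= andbA.
Qed.

Lemma chain_prod_cons (A : pzRingType) (b : nat -> nat -> A) (N t : nat)
    (x : 'I_N.+1) (w : t.+1.-tuple 'I_N.+1) :
  chain_prod b [tuple of x :: w] = b x (tnth w ord0) * chain_prod b w.
Proof.
rewrite /chain_prod big_ord_recl; congr (b _ _ * _).
- by rewrite (tnth_nth x) /= inordK.
- by rewrite !(tnth_nth x) /= inordK.
apply: eq_bigr => k _; rewrite !(tnth_nth x) /= /bump !add1n.
have lt_k := ltn_ord k.
by rewrite !inordK //= ?ltnS // ltnW.
Qed.

(** A chain from [n] with at least one step amounts to its second term
    [m < n] together with a chain from [m], which is the recursion that defines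
    [chain_sum]. *)
Lemma sum_chains (A : pzRingType) (b : nat -> nat -> A) (N t n i : nat) :
  (n <= N)%N ->
  \sum_(v : t.+1.-tuple 'I_N.+1 | chain_from n i v) chain_prod b v =
  chain_sum A b t n i.
Proof.
elim: t n => [|t IHt] n le_nN /=.
  under eq_bigr do rewrite /chain_prod big_ord0.
  rewrite (reindex (fun x : 'I_N.+1 => [tuple x])) /=; last first.
    exists (fun v => tnth v ord0) => [x _|v _]; first by rewrite (tnth_nth x).
    by apply: val_inj; case: v => -[|y []].
  rewrite (eq_bigl (fun x : 'I_N.+1 =>
    (x == inord n) && (n == i))) => [|x]; last first.
    rewrite /chain_from /= !(tnth_nth x) /= -val_eqE /= inordK //.
    by case: eqP => [->|].
  case: eqP => _; last by rewrite big_pred0 // => x; rewrite andbF.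
  by rewrite (big_pred1 (inord n)) // => x; rewrite andbT.
rewrite (reindex (fun p : 'I_N.+1 * t.+1.-tuple 'I_N.+1 =>
  [tuple of p.1 :: p.2])) /=; last first.
  exists (fun v => (thead v, [tuple of behead v])) => [[x w] _|v _] /=.
    by congr (_, _); apply: val_inj.
  by apply: val_inj; case: v => -[].
under eq_bigl do rewrite chain_from_cons.
under eq_bigr do rewrite chain_prod_cons.
rewrite -(pair_big_dep (fun x : 'I_N.+1 => x == n :> nat)
  (fun _ (w : t.+1.-tuple 'I_N.+1) =>
     (tnth w ord0 < n)%N && chain_from (tnth w ord0) i w)
  (fun x (w : t.+1.-tuple 'I_N.+1) => b x (tnth w ord0) * chain_prod b w)) /=.
rewrite (big_pred1 (inord n)) => [|x]; last by rewrite /= -val_eqE /= inordK.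
rewrite inordK //.
(* The remaining tuple w is the tail of the chain; its head is the second term
   of the chain, by which the sum is now grouped. *)
rewrite (partition_big (fun w : t.+1.-tuple 'I_N.+1 => tnth w ord0)
  (fun m : 'I_N.+1 => (m < n)%N)) /= => [|w /andP[]//].
transitivity (\sum_(m < N.+1 | (m < n)%N) b n m * chain_sum A b t m i).
  apply: eq_bigr => m lt_mn.
  rewrite -IHt ?(leq_trans (ltnW lt_mn)) // big_distrr /=.
  apply: eq_big => [w|w /andP[_ /eqP->]//].
  have [->|ne_m] := eqVneq (tnth w ord0) m; first by rewrite lt_mn andbT.
  by rewrite andbF /chain_from val_eqE (negPf ne_m) andbF.
rewrite -(big_mkord (fun m => (m < n)%N) (fun m => b n m * chain_sum A b t m i)).
rewrite -(big_nat_widen 0 n N.+1 predT) ?leqW //.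
Qed.

(** The entry at [(n, i)] of the first [K] terms of [(1 + B) ^-1]. *)
Definition neumann_sum (A : pzRingType) (b : nat -> nat -> A)
    (K n i : nat) : A :=
  \sum_(0 <= t < K) (-1) ^+ t * chain_sum A b t n i.

(** The geometric identity [S_(K + 1) = 1 - B * S_K], where [S_K] is the sum of
    the first [K] powers of [- B].  Once the sum is stable this is
    [(1 + B) * S_K = 1]. *)
Lemma neumann_sumS (A : pzRingType) (b : nat -> nat -> A) (K n i : nat) :
  neumann_sum A b K.+1 n i =
  (n == i)%:R - \sum_(0 <= m < n) b n m * neumann_sum A b K m i.
Proof.
rewrite /neumann_sum big_nat_recl // expr0 mul1r; congr (_ + _) => /=.
under [in RHS]eq_bigr do rewrite big_distrr /=.
rewrite exchange_big /= -sumrN; apply: eq_bigr => t _.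
rewrite exprS mulN1r mulNr big_distrr /=; congr (- _).
by apply: eq_bigr => m _; rewrite !mulrA (commr_sign (b n m)).
Qed.

(** By nilpotency the series stops at [t = n - i]. *)
Lemma neumann_sum_stable (A : pzRingType) (b : nat -> nat -> A)
    (K L n i : nat) :
  (K <= L)%N -> (n < i + K)%N -> neumann_sum A b L n i = neumann_sum A b K n i.
Proof.
move=> le_KL lt_n; rewrite /neumann_sum (big_cat_nat (n := K)) //=.
rewrite [X in _ + X]big_nat_cond [X in _ + X]big1 ?addr0 //.
move=> t /andP[/andP[le_Kt _] _].
by rewrite chain_sum_eq0 ?mulr0 // (leq_trans lt_n) // leq_add2l.
Qed.

(** Row [n] of [u = (1 + B) ^-1 psi].  Substituting the formula for the earlier
    terms into the recurrence produces row [n] of [neumann_sumS].  The same [M]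
    bounds both the number of powers and the index [i], whatever [n] is, so that
    the sums over [i] and over the earlier terms can be exchanged; the entries
    added above the diagonal vanish. *)
Lemma recurrence_neumann (A : comPzRingType) (psi : nat -> A)
    (b : nat -> nat -> A) (u : nat -> A) (M : nat) :
  (forall n, (1 <= n)%N -> u n = psi n - \sum_(1 <= i < n) b n i * u i) ->
  forall n, (1 <= n < M)%N ->
  u n = \sum_(1 <= i < M) psi i * neumann_sum A b M n i.
Proof.
move=> u_rec; elim/ltn_ind => n IHn /andP[n_gt0 lt_nM].
have -> : \sum_(1 <= i < M) psi i * neumann_sum A b M n i =
    \sum_(1 <= i < M) (psi i * (n == i)%:R -
      \sum_(1 <= m < n) b n m * (psi i * neumann_sum A b M m i)).
  apply: eq_big_nat => i /andP[i_gt0 _].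
  rewrite -(neumann_sum_stable A b M M.+1) ?leqnSn //; last first.
    by rewrite (leq_trans lt_nM) ?leq_addl.
  rewrite neumann_sumS mulrBr; congr (_ - _).
  (* The powers of B also involve the index 0, at which u satisfies nothing; no
     chain goes from 0 down to i >= 1. *)
  rewrite big_ltn // [neumann_sum _ _ _ 0 _]big1 ?mulr0 ?add0r => [|t _].
    by rewrite big_distrr /=; apply: eq_bigr => m _; rewrite mulrCA.
  by rewrite chain_sum_eq0 ?mulr0 // ltn_addr.
rewrite sumrB u_rec //; congr (_ - _).
  rewrite (bigD1_seq n) ?mem_index_iota ?n_gt0 ?iota_uniq //= eqxx mulr1.
  by rewrite big1 ?addr0 // => i; rewrite eq_sym => /negPf->; rewrite mulr0.
rewrite exchange_big /=; apply: eq_big_nat => m /andP[m_gt0 lt_mn].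
by rewrite (IHn m lt_mn) ?m_gt0 ?(ltn_trans lt_mn) // big_distrr.
Qed.

Theorem proposition4p1 (A : comPzRingType) (psi : nat -> A)
    (b : nat -> nat -> A) (u : nat -> A)
    (u1 : u 1%N = psi 1%N)
    (u_rec : forall n : nat, (2 <= n)%N ->
       u n = psi n - \sum_(1 <= i < n) b n i * u i)
    (n : nat) (n_ge1 : (1 <= n)%N) :
  u n = psi n + \sum_(1 <= i < n) psi i *
    \sum_(0 <= s < (n - 1 - i).+1) (-1) ^+ s.+1 *
      \sum_(v : s.+2.-tuple 'I_n.+1 | decreasing_chain i v)
        \prod_(k < s.+1) b (tnth v (inord k)) (tnth v (inord k.+1)).
Proof.
(* With the empty sum at k = 1, the recurrence covers the initial value. *)
have u_rec1 k : (1 <= k)%N -> u k = psi k - \sum_(1 <= i < k) b k i * u i.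
  by case: k => [|[|k]] // _; [rewrite big_geq // subr0 | apply: u_rec].
rewrite (recurrence_neumann A psi b u n.+1 u_rec1) ?n_ge1 ?ltnSn //.
(* The diagonal entry i = n gives psi n; below the diagonal the term t = 0
   vanishes, whence the shift from t to s = t - 1. *)
rewrite big_nat_recr //= addrC; congr (_ + _).
  rewrite (neumann_sum_stable A b 1) ?addn1 //.
  by rewrite /neumann_sum big_nat1 expr0 mul1r /= eqxx mulr1.
apply: eq_big_nat => i /andP[i_gt0 lt_in]; congr (_ * _).
rewrite (neumann_sum_stable A b (n - 1 - i).+2); first last.
- by rewrite -subnDA add1n addnS -addSnnS subnKC.
- by rewrite -subnDA add1n subnSK // ltnS leq_subr.
rewrite /neumann_sum [LHS]big_nat_recl // [chain_sum _ _ 0 _ _]/= (gtn_eqF lt_in) mulr0 add0r.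
by apply: eq_bigr => s _; rewrite -(sum_chains A b n).
Qed.
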